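(* Let $m\in\mathbb{N}$, $c\in(0,1)$, and let $\bar\tau\ge1$ be an integer. Let $\mathcal{P}=(P_0,\dots,P_{\bar\tau})$ and $\mathcal{P}'=(P'_0,\dots,P'_{\bar\tau})$ be probability distributions on $\{0,\dots,\bar\tau\}$ with $P_0<1$ and $P'_0<1$. If $\mathcal{P}\succeq_1\mathcal{P}'$, i.e. $\sum_{j=0}^iP_j\ge\sum_{j=0}^iP'_j$ for all $i\in\{0,\dots,\bar\tau\}$, then $\rho_{\mathcal{P}}\le\rho_{\mathcal{P}'}$.
   Context: For a probability distribution $\mathcal{P}=(P_0,\dots,P_{\bar\tau})$ on $\{0,\dots,\bar\tau\}$ (so $P_i\ge 0$, $\sum_i P_i=1$) with $P_0<1$, define $$\rho_c=1-\frac{1-c^2}{m},\qquad \rho_a=\rho_c^{\frac{1}{1+\bar\tau/m}},\qquad \phi(\rho)=\rho-\rho_c-\frac{c^2}{m}\Big(\sum_{i=0}^{\bar\tau}P_i\rho^{-i}-1\Big),$$ $$\alpha_{\mathcal{P}}=\frac{1}{1-\phi(\rho_a)/\phi(\rho_c)},\qquad \rho_{\mathcal{P}}=\alpha_{\mathcal{P}}\rho_a+(1-\alpha_{\mathcal{P}})\rho_c .$$ (For these distributions $\phi(\rho_c)<0\le\phi(\rho_a)$, so $\alpha_{\mathcal{P}}$ is well defined.) The quantity $\rho_{\mathcal{P}'}$ is defined in the same way with $P_i$ replaced by $P'_i$ and the same $m$, $c$, $\bar\tau$. *)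

(* Defs.v *)
From mathcomp Require Import all_boot all_order all_algebra.
From mathcomp Require Import all_classical all_reals all_analysis.

Set Implicit Arguments.
Unset Strict Implicit.
Unset Printing Implicit Defensive.

Import Order.TTheory GRing.Theory Num.Theory.

Local Open Scope ring_scope.

(* A distribution on {0, ..., tau} is given by its masses [P : 'I_tau.+1 -> R]. *)
Definition is_distr (R : realType) (tau : nat) (P : 'I_tau.+1 -> R) : Prop :=
  (forall i, 0 <= P i) /\ \sum_i P i = 1.

(* First-order stochastic dominance, comparing cumulative sums: the dominating
   distribution puts more mass on small values. *)
Definition dominates1 (R : realType) (tau : nat) (P P' : 'I_tau.+1 -> R) : Prop :=
  forall i : 'I_tau.+1,
    \sum_(j < tau.+1 | (j <= i)%N) P' j <= \sum_(j < tau.+1 | (j <= i)%N) P j.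

Definition rho_c (R : realType) (m : nat) (c : R) : R :=
  1 - (1 - c ^+ 2) / m%:R.

Definition rho_a (R : realType) (m : nat) (c : R) (tau : nat) : R :=
  rho_c m c `^ (1 / (1 + tau%:R / m%:R)).

Definition phi (R : realType) (m : nat) (c : R) (tau : nat)
    (P : 'I_tau.+1 -> R) (rho : R) : R :=
  rho - rho_c m c - c ^+ 2 / m%:R * (\sum_(i < tau.+1) P i * rho ^- i - 1).

Definition alphaP (R : realType) (m : nat) (c : R) (tau : nat)
    (P : 'I_tau.+1 -> R) : R :=
  1 / (1 - phi m c P (rho_a m c tau) / phi m c P (rho_c m c)).

Definition rhoP (R : realType) (m : nat) (c : R) (tau : nat)
    (P : 'I_tau.+1 -> R) : R :=
  alphaP m c P * rho_a m c tau + (1 - alphaP m c P) * rho_c m c.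

(* Main.v *)
Require Import Defs.
From mathcomp Require Import all_boot all_order all_algebra.
From mathcomp Require Import all_classical all_reals all_analysis.
From mathcomp Require Import ring lra.

(** The interpolation weight [alphaP] is [1 / (1 + t)] with
    [t = phi rho_a / - phi rho_c], and [rhoP] moves from [rho_c] up to [rho_a]
    as the weight grows; so the claim is that [t] does not increase when [P] is
    replaced by [P'].

    For [rho] in [(0, 1]] the weights [rho ^- i] increase with [i], so moving
    mass to larger values raises the expectation of [rho ^- i]
    ([dominates1_ler_sum], a summation by parts) and lowers [phi rho]
    ([ler_phi_dominates]). Hence the numerator of [t] goes down and its
    denominator goes up. With a positive denominator ([phi_rho_c_lt0]) and a
    nonnegative numerator ([phi_rho_a_ge0]), [t] goes down.

    The sign at [rho_a] is the one quantitative point. The worst case is all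
    the mass at [tau]. With [x = rho_a] and [y = x `^ (tau / m)], the
    definition of [rho_a] gives [rho_c = x * y] and [x ^+ tau = y ^+ m], and
    [x <= 1] reduces the inequality to Bernoulli's [1 + m (y - 1) <= y ^+ m]. *)

Set Implicit Arguments.
Unset Strict Implicit.
Unset Printing Implicit Defensive.

Import Order.TTheory GRing.Theory Num.Theory.

Local Open Scope ring_scope.

Lemma bernoulli_ineq (R : realDomainType) (n : nat) (y : R) :
  0 <= y -> 1 + n%:R * (y - 1) <= y ^+ n.
Proof.
move=> y0; elim: n => [|n IHn]; first by rewrite mul0r addr0 expr0.
rewrite exprS; apply: le_trans (ler_wpM2l y0 IHn).
have : 0 <= n%:R * (y - 1) ^+ 2 by rewrite mulr_ge0 ?ler0n ?sqr_ge0.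
rewrite -natr1; lra.
Qed.

Lemma ler_exprV (R : numFieldType) (x : R) (i j : nat) :
  0 < x <= 1 -> (i <= j)%N -> x ^- i <= x ^- j.
Proof.
move=> /andP[x0 x1] ij.
by rewrite lef_pV2 ?posrE ?exprn_gt0// ler_wiXn2l// ltW.
Qed.

Lemma powR_le1 (R : realType) (x e : R) : 0 < x <= 1 -> 0 <= e -> x `^ e <= 1.
Proof. by move=> x01 e0; rewrite -[leRHS](powRr0 x) ger_powR. Qed.

(** * First-order dominance and expectations *)

(** Summation by parts: each [f i] is [f n] minus the increments of [f] from
    [i] to [n], and the increment at [k] is then charged to all [i <= k]. *)
Lemma sum_by_parts (R : pzRingType) (n : nat) (P : 'I_n.+1 -> R) (f : nat -> R) :
  \sum_i P i * f i = (\sum_i P i) * f n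
    - \sum_(k < n) (\sum_(i < n.+1 | (i <= k)%N) P i) * (f k.+1 - f k).
Proof.
under [X in _ - X]eq_bigr do rewrite mulr_suml.
rewrite (exchange_big_dep predT)//= mulr_suml -sumrB.
apply: eq_bigr => i _.
rewrite -mulr_sumr -(big_geq_mkord _ _ predT (fun k => f k.+1 - f k)).
rewrite telescope_sumr; last by rewrite -ltnS.
by rewrite mulrBr subKr.
Qed.

Lemma dominates1_ler_sum (R : realType) (tau : nat) (P P' : 'I_tau.+1 -> R)
    (f : nat -> R) :
  {homo f : i j / (i <= j)%N >-> i <= j} ->
  \sum_i P i = \sum_i P' i -> dominates1 P P' ->
  \sum_i P i * f i <= \sum_i P' i * f i.
Proof.
move=> f_mono sumPP' PP'; rewrite !sum_by_parts sumPP' lerB//.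
apply: ler_sum => k _; rewrite ler_wpM2r ?subr_ge0 ?f_mono//.
exact: PP' (widen_ord (leqnSn tau) k).
Qed.

(** * The two interpolation points *)

Section InterpolationPoints.
Variables (R : realType) (m : nat) (c : R) (tau : nat).
Hypotheses (m_gt0 : (0 < m)%N) (c01 : 0 < c < 1).

Let mR_gt0 : 0 < m%:R :> R. Proof. by rewrite ltr0n. Qed.

Let weight_gt0 : 0 < c ^+ 2 / m%:R.
Proof. by case/andP: c01 => c0 _; rewrite divr_gt0 ?exprn_gt0. Qed.

Lemma rho_c_itv : 0 < rho_c m c < 1.
Proof.
case/andP: c01 => c0 c1.
have c2_lt1 : c ^+ 2 < 1 by rewrite expr_lt1// ltW.
have mV_le1 : m%:R^-1 <= 1 :> R by rewrite invf_le1// ler1n.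
have mV_gt0 : 0 < m%:R^-1 :> R by rewrite invr_gt0.
have := weight_gt0; rewrite /rho_c => w_gt0; apply/andP; split; nra.
Qed.

Lemma rho_a_gt0 : 0 < rho_a m c tau.
Proof. by case/andP: rho_c_itv => r0 _; rewrite powR_gt0. Qed.

(** Both relations used about [rho_a] are expressed through its power of
    exponent [tau / m]: it carries [rho_a] to [rho_c], and is an [m]-th root of
    [rho_a ^+ tau]. *)
Lemma rho_a_rel : let y := rho_a m c tau `^ (tau%:R / m%:R) in
  rho_a m c tau * y = rho_c m c /\ y ^+ m = rho_a m c tau ^+ tau.
Proof.
case/andP: rho_c_itv => rc0 _; have ra0 := rho_a_gt0.
have e_gt0 : 0 < 1 + tau%:R / m%:R :> R by rewrite ltr_pwDl// divr_ge0.
move=> y; split.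
  rewrite -[X in X * y]powRr1 ?ltW// -powRD; last first.
    by rewrite (gt_eqF ra0) implybT.
  by rewrite /rho_a -powRrM mulrC mul1r divff ?gt_eqF// powRr1// ltW.
rewrite -powR_mulrn ?powR_ge0// -powRrM mulfVK ?gt_eqF//.
by rewrite powR_mulrn// ltW.
Qed.

Lemma rho_a_le1 : rho_a m c tau <= 1.
Proof.
case/andP: rho_c_itv => rc0 rc1.
by rewrite powR_le1 ?rc0 ?(ltW rc1)// mul1r invr_ge0 addr_ge0// divr_ge0.
Qed.

Lemma rho_c_le_rho_a : rho_c m c <= rho_a m c tau.
Proof.
have [<- _] := rho_a_rel; rewrite ler_piMr ?(ltW rho_a_gt0)//.
by rewrite powR_le1 ?rho_a_gt0 ?rho_a_le1// divr_ge0.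
Qed.

(** * Signs and monotonicity of [phi] *)

Lemma ler_phi_dominates (P P' : 'I_tau.+1 -> R) (x : R) :
  0 < x <= 1 -> is_distr P -> is_distr P' -> dominates1 P P' ->
  phi m c P' x <= phi m c P x.
Proof.
move=> x01 [_ sumP] [_ sumP'] PP'.
rewrite lerB// ler_wpM2l ?(ltW weight_gt0)// lerB//.
apply: (dominates1_ler_sum (f := fun i => x ^- i)) => //; last first.
  by rewrite sumP sumP'.
by move=> i j; exact: ler_exprV.
Qed.

(** At [rho_c] only the expectation term of [phi] remains; it is at least
    [P 0 + (1 - P 0) / rho_c], which exceeds [1] because [P 0 < 1]. *)
Lemma phi_rho_c_lt0 (P : 'I_tau.+1 -> R) :
  is_distr P -> P ord0 < 1 -> phi m c P (rho_c m c) < 0.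
Proof.
move=> [P_ge0]; rewrite /phi !big_ord_recl/= => sumP P0_lt1.
case/andP: rho_c_itv; set r := rho_c m c => r0 r1.
rewrite subrr sub0r oppr_lt0 mulr_gt0 ?weight_gt0// subr_gt0.
rewrite expr0 invr1 mulr1.
set Q := \sum_(i < tau) P _ in sumP.
have Q_gt0 : 0 < Q by lra.
rewrite -sumP ltrD2l; apply: (@lt_le_trans _ _ (Q * r^-1)).
  by rewrite ltr_pMr// invf_gt1.
rewrite mulr_suml; apply: ler_sum => i _; rewrite ler_wpM2l//.
by rewrite -[r in r^-1]expr1; apply: ler_exprV; rewrite ?r0 ?(ltW r1).
Qed.

(** Bounding the expectation by its worst value [rho_a ^- tau] leaves an
    inequality in [x = rho_a] and [y] with [x * y = rho_c]; the weight
    [c ^+ 2 / m] equals [x * y - 1 + 1 / m], and after multiplication by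
    [y ^+ m] and [x <= 1] what remains is Bernoulli's inequality. *)
Lemma phi_rho_a_ge0 (P : 'I_tau.+1 -> R) :
  is_distr P -> 0 <= phi m c P (rho_a m c tau).
Proof.
move=> [P_ge0 sumP].
have [] := rho_a_rel; set y := _ `^ _; have := rho_a_le1; have := rho_a_gt0.
rewrite /phi; set x := rho_a _ _ _ => x0 x1 xy ym.
have y0 : 0 < y by rewrite powR_gt0.
have y1 : y <= 1 by rewrite powR_le1 ?x0 ?x1// divr_ge0.
have sum_le : \sum_(i < tau.+1) P i * x ^- i <= y ^- m.
  rewrite ym -[leRHS]mul1r -sumP mulr_suml; apply: ler_sum => i _.
  by rewrite ler_wpM2l// ler_exprV ?x0 ?x1// -ltnS.
have weightE : c ^+ 2 / m%:R = x * y - 1 + m%:R^-1.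
  by rewrite xy /rho_c mulrBl; ring.
rewrite -xy.
suff worst : c ^+ 2 / m%:R * (y ^- m - 1) <= x - x * y.
  rewrite subr_ge0; apply: le_trans worst.
  by rewrite ler_wpM2l ?(ltW weight_gt0)// lerB.
have yVK : (y ^- m - 1) * y ^+ m = 1 - y ^+ m.
  by rewrite mulrBl mul1r mulVf// expf_neq0// gt_eqF.
rewrite -(ler_pM2r (exprn_gt0 m y0)) -[leLHS]mulrA yVK weightE.
have bern := bernoulli_ineq m (ltW y0).
have bernV : 1 - m%:R^-1 - y + m%:R^-1 * y ^+ m >= 0.
  rewrite -(pmulr_rge0 _ mR_gt0).
  have -> : m%:R * (1 - m%:R^-1 - y + m%:R^-1 * y ^+ m)
      = y ^+ m - (1 + m%:R * (y - 1)) by field; rewrite gt_eqF.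
  by rewrite subr_ge0.
have ym_le : y ^+ m <= y.
  by rewrite -{2}(expr1 y) ler_wiXn2l// ltW.
(* The difference of the two sides is the Bernoulli remainder [bernV] plus
   this product. *)
have : 0 <= (1 - x) * (y - y ^+ m) by rewrite mulr_ge0 ?subr_ge0.
by nra.
Qed.

End InterpolationPoints.

Theorem lemma3 (R : realType) (m : nat) (c : R) (tau : nat)
    (P P' : 'I_tau.+1 -> R) :
  (0 < m)%N -> 0 < c < 1 -> (1 <= tau)%N ->
  is_distr P -> is_distr P' ->
  P ord0 < 1 -> P' ord0 < 1 ->
  dominates1 P P' ->
  rhoP m c P <= rhoP m c P'.
Proof.
move=> m0 c01 _ dP dP' P0 P'0 PP'.
have /andP[rc0 rc1] := rho_c_itv m0 c01.
have rca := rho_c_le_rho_a tau m0 c01.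
have phic : phi m c P' (rho_c m c) <= phi m c P (rho_c m c).
  by apply: ler_phi_dominates; rewrite ?rc0 ?ltW.
have phia : phi m c P' (rho_a m c tau) <= phi m c P (rho_a m c tau).
  by apply: ler_phi_dominates; rewrite ?rho_a_gt0 ?rho_a_le1.
have phic_lt0 := phi_rho_c_lt0 m0 c01 dP P0.
have phic'_lt0 := phi_rho_c_lt0 m0 c01 dP' P'0.
have phia_ge0 := phi_rho_a_ge0 m0 c01 dP.
have phia'_ge0 := phi_rho_a_ge0 m0 c01 dP'.
have alphaE (Q : 'I_tau.+1 -> R) : alphaP m c Q
    = (1 + phi m c Q (rho_a m c tau) / - phi m c Q (rho_c m c))^-1.
  by rewrite /alphaP mul1r invrN mulrN.
suff alpha_le : alphaP m c P <= alphaP m c P'.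
  have rhoE (Q : 'I_tau.+1 -> R) : rhoP m c Q
      = rho_c m c + alphaP m c Q * (rho_a m c tau - rho_c m c).
    by rewrite /rhoP; ring.
  by rewrite !rhoE lerD2l ler_wpM2r// subr_ge0.
rewrite !alphaE lef_pV2 ?posrE ?ltr_pwDl ?divr_ge0 ?oppr_ge0
  ?(ltW phic_lt0) ?(ltW phic'_lt0)//.
rewrite lerD2l ler_pM ?invr_ge0 ?oppr_ge0 ?(ltW phic'_lt0)//.
by rewrite lef_pV2 ?posrE ?oppr_gt0// lerN2.
Qed.
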